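(* Let $(a(n))_{n\in\mathbb{N}}$ be an increasing sequence of distinct integers such that $\lim_{n\to\infty} a(n+1)/a(n)=p$ for some real number $p$ (not necessarily an integer). Then for (Lebesgue-)almost all real numbers $x$, the sequence $a_x(n):=a(n)x\bmod 1$ has entropy at least $\log p$, i.e. $\mathrm{AE}(a_x)\ge\log p$.
   Context: $\mathbb{N}=\{0,1,2,\dots\}$; $a(n)x\bmod 1$ is regarded as an element of $\mathbb{R}/\mathbb{Z}$; $\log$ is the natural logarithm. Entropy of a sequence: let $x=(x(n))_{n\in\mathbb{N}}$ be a sequence in $K=\mathbb{R}/\mathbb{Z}$, or a bounded sequence in $K=\mathbb{C}$. Let $X_0$ be the closure of $\{x(n):n\in\mathbb{N}\}$ in $K$ (a compact space), and let $X_x$ be the closure of $\{(x(m),x(m+1),x(m+2),\dots): m\in\mathbb{N}\}$ in $X_0^{\mathbb{N}}$ with the product topology. The shift $\sigma:(\omega_0,\omega_1,\dots)\mapsto(\omega_1,\omega_2,\dots)$ maps $X_x$ continuously to itself. The (anqie) entropy of $x$, denoted $\mathrm{AE}(x)\in[0,\infty]$, is the topological entropy of $(X_x,\sigma)$: the supremum over open covers $\mathcal{U}$ of $X_x$ of $\lim_{n}\frac1n\log\mathcal{N}(\mathcal{U}\vee\sigma^{-1}\mathcal{U}\vee\cdots\vee\sigma^{-n+1}\mathcal{U})$, where $\mathcal{N}(\mathcal{W})$ is the minimal cardinality of a subcover of $\mathcal{W}$. *)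

(* Defs.v *)
From mathcomp Require Import all_boot all_order all_algebra.
From mathcomp Require Import all_classical all_reals all_analysis.
Set Implicit Arguments.
Unset Strict Implicit.
Unset Printing Implicit Defensive.
Import Order.TTheory GRing.Theory Num.Theory.
Import numFieldNormedType.Exports.
Local Open Scope classical_set_scope.
Local Open Scope ring_scope.

(* The quotient group R/Z, with the quotient topology; Num.int_num_subdef is the
   predicate underlying the qualifier Num.int. *)
Definition RmodZ (R : realType) :=
  @Quotient.quot R (Num.int_num_subdef : {pred R}).

Definition circle (R : realType) : topologicalType := quotient_topology (RmodZ R).

Definition mod1 (R : realType) (x : R) : circle R := (\pi_(RmodZ R) x)%qT.

Section TopologicalEntropy.
Variables (T : topologicalType) (A : set T) (f : T -> T).

(* The space is A with the subspace topology; f is meant to map A into A.  A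
   cover is an unindexed family of subsets of A. *)
Definition is_cover (U : set (set T)) : Prop :=
  (forall B, U B -> B `<=` A) /\ \bigcup_(B in U) B = A.

Definition is_open_cover (U : set (set T)) : Prop :=
  is_cover U /\ forall B, U B -> exists2 V, open V & B = A `&` V.

Definition cover_join (U V : set (set T)) : set (set T) :=
  [set B `&` C | B in U & C in V].

Definition cover_preimage (i : nat) (U : set (set T)) : set (set T) :=
  [set A `&` (iter i f @^-1` B) | B in U].

(* The join over 0 <= i < n; its neutral element is the one-set cover {A}. *)
Definition cover_iter_join (U : set (set T)) (n : nat) : set (set T) :=
  \big[cover_join/[set A]]_(i < n) cover_preimage i U.

(* Minimal cardinality of a subcover, +oo if no subcover is finite. *)
Definition min_subcover (R : realType) (W : set (set T)) : \bar R :=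
  ereal_inf [set (n%:R)%:E | n in
    [set n | exists V, [/\ V `<=` W, is_cover V & (V #= `I_n)%card]]].

Definition cover_entropy (R : realType) (U : set (set T)) : \bar R :=
  limn (fun n => (n%:R^-1)%:E * lne (min_subcover R (cover_iter_join U n)))%E.

Definition topological_entropy (R : realType) : \bar R :=
  ereal_sup [set cover_entropy R U | U in is_open_cover].

End TopologicalEntropy.

Section AnqieEntropy.
Variables (K : topologicalType) (x : nat -> K).

Definition seq_shift (w : {ptws nat -> K}) : {ptws nat -> K} := fun n => w n.+1.

Definition value_space : set K := closure (range x).

(* The closure of the orbit relative to value_space^N is the trace on it of the
   closure in K^N. *)
Definition orbit_space : set {ptws nat -> K} :=
  [set w | forall n, value_space (w n)] `&`
  closure (range (fun m => (fun n => x (m + n)%N) : {ptws nat -> K})).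

Definition anqie_entropy (R : realType) : \bar R :=
  topological_entropy orbit_space seq_shift R.

End AnqieEntropy.

(* Main.v *)
Require Import Defs.
From mathcomp Require Import all_boot all_order all_algebra.
From mathcomp Require Import all_classical all_reals all_analysis.
From mathcomp Require Import finmap measurable_realfun ring lra zify.
Import Order.TTheory GRing.Theory Num.Theory.
Import numFieldNormedType.Exports.
Local Open Scope classical_set_scope.
Local Open Scope ring_scope.

(* Cover the orbit closure by the M sets "the coordinate 0 lies in the arc of
   half-width 1/M around j/M".  An element of the n-th join then prescribes an
   arc for a(m) x, ..., a(m+n-1) x.  If M is large compared with p, the integer
   part of a(m) x and these arcs determine the integer parts of the later
   a(m+i) x, so the prescription confines x, in a fixed interval J, to at most
   about a(m) |J| sets of diameter 2 / (M a(m+n-1)), where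
   a(m+n-1) / a(m) tends to p^(n-1).  Hence for any p^(n-1) prescriptions, the
   set of x obeying one of them for every m occupies at most half of each
   interval, and is null by the Lebesgue density theorem.  There are countably
   many families of prescriptions, so for almost all x every subcover of the
   n-th join has more than p^(n-1) elements for all n.  Minimal subcover sizes
   are submultiplicative, so by Fekete's lemma the limit defining the entropy
   of the cover exists, and it is at least log p. *)

(** * Subcovers of iterated joins *)

Section SubcoverCount.
Context {T : topologicalType} (A : set T) (f : T -> T).
Implicit Types (U : set (set T)).

Definition itinerary n (B : nat -> set T) : set T :=
  A `&` [set w | forall i, (i < n)%N -> B i (iter i f w)].

Lemma cover_iter_joinE U n :
  cover_iter_join A f U n =
    [set W | exists2 B, (forall i, (i < n)%N -> U (B i)) & W = itinerary n B].
Proof.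
rewrite /cover_iter_join.
(* The start [k] is generalised because splitting off the first factor of the join shifts the
   exponents of the others by one. *)
suff H k : \big[@cover_join T/[set A]]_(i < n) cover_preimage A f (k + i) U =
    [set W | exists2 B, (forall i, (i < n)%N -> U (B i)) &
      W = A `&` [set w | forall i, (i < n)%N -> B i (iter (k + i) f w)]].
  by have := H 0%N.
elim: n k => [|n IHn] k.
  rewrite big_ord0; apply/seteqP; split => W /=.
    move=> ->; exists (fun=> A) => //.
    by apply/seteqP; split => [w Aw|w []].
  by move=> [B _ ->]; apply/seteqP; split => [w []|w Aw].
rewrite big_ord_recl /=.
under eq_bigr => i _ do rewrite /bump /= add1n addnS -addSn.
rewrite IHn addn0; apply/seteqP; split => W /=.
  move=> [_ [B0 UB0 <-]] [_ [B UB ->]] <-.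
  exists (fun i => if i is j.+1 then B j else B0).
    by case => // i; rewrite ltnS => /UB.
  apply/seteqP; split => [w /= [[Aw B0w] [_ Bw]]|w /= [Aw Bw]].
    split=> //; case => [_|i]; first by rewrite addn0.
    by rewrite ltnS addnS => /Bw.
  split; first by split=> //; have := Bw 0%N isT; rewrite addn0.
  by split=> // i ni; have := Bw i.+1 ni; rewrite addnS.
move=> [B UB ->]; exists (A `&` (iter k f @^-1` B 0%N)).
  by exists (B 0%N) => //; exact: UB.
exists (A `&` [set w | forall i, (i < n)%N -> B i.+1 (iter (k.+1 + i) f w)]).
  by exists (fun i => B i.+1) => // i ni; exact: UB.
apply/seteqP; split => [w /= [[Aw B0w] [_ Bw]]|w /= [Aw Bw]].
  split=> //; case => [_|i]; first by rewrite addn0.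
  by rewrite ltnS addnS => /Bw.
split; first by split=> //; have := Bw 0%N isT; rewrite addn0.
by split=> // i ni; have := Bw i.+1 ni; rewrite addnS.
Qed.

Definition subcover_card U n k := exists V,
  [/\ V `<=` cover_iter_join A f U n, is_cover A V & (V #= `I_k)%card].

Lemma cover_iter_joinD U m n (V W : set T) : (forall w, A w -> A (f w)) ->
  cover_iter_join A f U m V -> cover_iter_join A f U n W ->
  cover_iter_join A f U (m + n) (V `&` iter m f @^-1` W).
Proof.
move=> fA; rewrite !cover_iter_joinE => -[B UB ->] [C UC ->].
have fmA k w : A w -> A (iter k f w) by move=> Aw; elim: k => //= k /fA.
exists (fun i => if (i < m)%N then B i else C (i - m)%N).
  move=> i imn; case: ltnP => [/UB//|mi]; apply: UC; lia.
apply/seteqP; split => [w /= [[Aw Bw] [_ Cw]]|w /= [Aw H]].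
  split=> // i imn; case: ltnP => [/Bw//|mi].
  have := Cw (i - m)%N; rewrite -iterD subnK//; apply; lia.
split.
  by split=> // i im; have := H i; rewrite im; apply; lia.
split; first exact: fmA.
move=> i ni; have := H (m + i)%N; rewrite ltn_add2l [(_ < m)%N]ltnNge leq_addr/=.
by rewrite addKn [(m + i)%N]addnC iterD; apply.
Qed.

Lemma is_cover_iter_join U n : (forall w, A w -> A (f w)) -> is_cover A U ->
  is_cover A (cover_iter_join A f U n).
Proof.
move=> fA [UA covU]; rewrite cover_iter_joinE.
have fmA k w : A w -> A (iter k f w) by move=> Aw; elim: k => //= k /fA.
split; first by move=> _ [B _ ->] w [].
apply/seteqP; split; first by move=> w [_ [B _ ->] []].
move=> w Aw.
have /choice[B HB] i : exists B, U B /\ B (iter i f w).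
  have := fmA i w Aw; rewrite -{1}covU => -[B UB Bw]; by exists B.
exists (itinerary n B); first by exists B => // i _; exact: (HB i).1.
by split=> // i _; exact: (HB i).2.
Qed.

Lemma finite_cover_iter_join U n :
  finite_set U -> finite_set (cover_iter_join A f U n).
Proof.
move=> finU; rewrite /cover_iter_join.
elim/big_rec: _ => [|i V _ finV]; first exact: finite_set1.
by apply: finite_image2 => //; exact: finite_image.
Qed.

(** Intersect each element of [V] with the preimage under the [m]-th iterate of each element of [W].
    Different pairs may give the same set, hence an inequality for [j]. *)
Lemma subcover_cardD U m n k l : (forall w, A w -> A (f w)) ->
  subcover_card U m k -> subcover_card U n l ->
  exists2 j, (j <= k * l)%N & subcover_card U (m + n) j.
Proof.
move=> fA [V [Vm [VA covV] cardV]] [W [Wn [WA covW] cardW]].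
have finV : finite_set V by exists k.
have finW : finite_set W by exists l.
have fmA k' w : A w -> A (iter k' f w) by move=> Aw; elim: k' => //= j /fA.
pose Z := [set B `&` iter m f @^-1` C | B in V & C in W].
have finZ : finite_set Z by exact: finite_image2.
exists #|` fset_set Z|.
  rewrite -(card_fset_set cardV) -(card_fset_set cardW).
  rewrite -(size_allpairs (fun B C => B `&` iter m f @^-1` C)).
  apply: uniq_leq_size => [|X]; first exact: fset_uniq.
  rewrite in_fset_set// => /set_mem[B VB] [C WC] <-.
  by apply: allpairs_f; rewrite in_fset_set// ?inE; exact: mem_set.
exists Z; split.
- by move=> _ [B VB] [C WC] <-; apply: cover_iter_joinD => //; [exact: Vm|exact: Wn].
- split; first by move=> _ [B VB] [C WC] <- w [/(VA _ VB)].
  apply/seteqP; split; first by move=> w [_ [B VB] [C WC] <-] [/(VA _ VB)].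
  move=> w Aw.
  have := Aw; rewrite -{1}covV => -[B VB Bw].
  have := fmA m w Aw; rewrite -{1}covW => -[C WC Cw].
  by exists (B `&` iter m f @^-1` C) => //; exists B => //; exists C.
- by rewrite -{1}(fset_setK finZ); exact/card_eq_fsetP.
Qed.


Lemma subcover_card_ex U n : (forall w, A w -> A (f w)) -> is_cover A U ->
  finite_set U -> exists k, subcover_card U n k.
Proof.
move=> fA covU finU.
have [k Uk] := finite_cover_iter_join U n finU.
exists k, (cover_iter_join A f U n); split=> //.
exact: is_cover_iter_join.
Qed.

Lemma subcover_card_gt0 U n k : A !=set0 -> subcover_card U n k -> (0 < k)%N.
Proof.
move=> [w Aw] [V [_ [_ covV] cardV]]; rewrite lt0n; apply/negP => /eqP k0.
move: cardV Aw; rewrite k0 II0 card_eq0 => /eqP V0.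
by rewrite -covV V0 bigcup_set0.
Qed.

Lemma min_subcoverE (R : realType) U n k : subcover_card U n k ->
  (forall j, subcover_card U n j -> (k <= j)%N) ->
  min_subcover A R (cover_iter_join A f U n) = k%:R%:E.
Proof.
move=> Uk kmin; apply/eqP; rewrite eq_le; apply/andP; split.
  by apply: ereal_inf_lbound; exists k.
by apply: le_ereal_inf_tmp => _ [j Uj <-]; rewrite lee_fin ler_nat kmin.
Qed.

End SubcoverCount.

(** * Growth of subcovers and entropy *)

(** Pick [q.+1] whose average is within e/2 of the infimum and divide [n] by it. Subadditivity
    bounds the quotient part by n (inf + e/2) and the remainder part by the constant [C], which is
    below n e/2 for large [n]. *)
Lemma fekete (R : realType) (u : nat -> R) : (forall n, 0 <= u n) ->
  (forall m n, u (m + n)%N <= u m + u n) ->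
  (fun n => n%:R^-1 * u n) @ \oo --> inf [set n.+1%:R^-1 * u n.+1 | n in setT].
Proof.
move=> u0 uD; set S := [set _ | _ in _]; set L := inf S.
have infS : has_inf S.
  split; first by exists (1%:R^-1 * u 1%N); exists 0%N.
  by exists 0 => _ [n _ <-]; rewrite mulr_ge0.
have umul q k r : u (k * q + r)%N <= k%:R * u q + u r.
  elim: k => [|k IHk]; first by rewrite mul0n mul0r add0r.
  rewrite mulSn -addnA (le_trans (uD _ _))// -natr1 mulrDl mul1r.
  by rewrite [k%:R * _ + _]addrC -addrA lerD2l.
apply/cvgrPdist_lt => e e0.
have e20 : 0 < e / 2 by rewrite divr_gt0.
have [_ [q _ <-] qe] := inf_adherent e20 infS.
pose C := \sum_(i < q.+1) u i.
have C0 : 0 <= C by exact: sumr_ge0.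
near=> n.
have n0 : (0 < n)%N by near: n; exists 1%N.
have nR0 : 0 < n%:R :> R by rewrite ltr0n.
have nC : C < e / 2 * n%:R.
  rewrite -ltr_pdivrMl// mulrC; near: n; exact: nbhs_infty_gtr.
have Ln : L <= n%:R^-1 * u n.
  apply: ge_inf; first exact: infS.2.
  by exists n.-1 => //; rewrite prednK.
rewrite distrC ger0_norm ?subr_ge0// ltrBlDr addrC.
rewrite mulrC ltr_pdivrMr//.
have uC : u (n %% q.+1)%N <= C.
  rewrite /C (bigD1 (Ordinal (ltn_pmod n (ltn0Sn q))))//= lerDl.
  exact: sumr_ge0.
have kq : (n %/ q.+1)%:R * u q.+1 <= n%:R * (q.+1%:R^-1 * u q.+1).
  rewrite mulrA ler_wpM2r// ler_pdivlMr ?ltr0n// -natrM ler_nat.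
  exact: leq_trunc_div.
have := umul q.+1 (n %/ q.+1)%N (n %% q.+1)%N; rewrite -divn_eq.
have : n%:R * (q.+1%:R^-1 * u q.+1) < n%:R * (inf S + e / 2) by rewrite ltr_pM2l.
rewrite -/L => H1 H2.
rewrite (le_lt_trans H2)// (le_lt_trans (lerD kq uC))// (lt_le_trans (ltrD H1 nC))//.
by rewrite le_eqVlt; apply/orP; left; apply/eqP; field.
Unshelve. all: by end_near. Qed.

(** The factor [c] adds only [ln c / n] to the normalised logarithm, which vanishes in the limit, so
    an off-by-one in the exponent of [q] costs nothing. *)
Lemma cover_entropy_ge (R : realType) (T : topologicalType) (A : set T)
    (f : T -> T) (U : set (set T)) (c q : R) :
  A !=set0 -> (forall w, A w -> A (f w)) -> is_cover A U -> finite_set U ->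
  0 < c -> 0 < q ->
  (forall n k, subcover_card A f U n k -> c * q ^+ n <= k%:R) ->
  ((ln q)%:E <= cover_entropy A f R U)%E.
Proof.
move=> A0 fA covU finU c0 q0 Nge.
have /choice[N HN] n : exists k, subcover_card A f U n k /\
    forall j, subcover_card A f U n j -> (k <= j)%N.
  have exk : exists k, `[< subcover_card A f U n k >].
    by have [k Uk] := subcover_card_ex A f U n fA covU finU; exists k; exact/asboolP.
  case: (ex_minnP exk) => k /asboolP Uk kmin; exists k; split=> // j Uj.
  exact/kmin/asboolP.
have N0 n : (0 < (N n)%:R :> R).
  by rewrite ltr0n; exact: subcover_card_gt0 A0 (HN n).1.
pose u n : R := ln (N n)%:R.
have u0 n : 0 <= u n by rewrite ln_ge0// ler1n -(ltr0n R).
have uD m n : u (m + n)%N <= u m + u n.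
  have [j jN Uj] := subcover_cardD _ _ _ _ _ _ _ fA (HN m).1 (HN n).1.
  rewrite -lnM ?posrE// ler_ln ?posrE ?mulr_gt0// -natrM ler_nat.
  exact: leq_trans ((HN _).2 _ Uj) jN.
(* The entropy is a [limn], and the comparison of limits below requires the sequence to converge. *)
have cvgu := fekete R u u0 uD.
rewrite /cover_entropy.
under eq_fun => n do
  rewrite (min_subcoverE _ _ _ _ _ _ (HN n).1 (HN n).2) lne_EFin// -EFinM.
rewrite EFin_lim; last by apply/cvg_ex; eexists; exact: cvgu.
rewrite lee_fin.
have cvgl : (fun n : nat => n%:R^-1 * ln c + ln q) @ \oo --> ln q.
  rewrite -[X in _ --> X]add0r; apply: cvgD; last exact: cvg_cst.
  rewrite -(mul0r (ln c)); apply: cvgMl.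
  apply/gtr0_cvgV0; last exact: cvgr_idn.
  by near=> n; rewrite ltr0n; near: n; exists 1%N.
rewrite -(cvg_lim _ cvgl)//; apply: ler_lim.
- by apply/cvg_ex; eexists; exact: cvgl.
- by apply/cvg_ex; eexists; exact: cvgu.
- near=> n.
  have n0 : 0 < n%:R :> R by rewrite ltr0n; near: n; exists 1%N.
  rewrite -(ler_pM2l n0) mulrDr !mulVKf ?gt_eqF//.
  rewrite mulr_natl -lnXn// -lnM ?posrE ?exprn_gt0//.
  by rewrite ler_ln ?posrE ?mulr_gt0 ?exprn_gt0//; exact: Nge (HN n).1.
Unshelve. all: by end_near. Qed.

(** * Arcs of the circle *)

(** The half-width equals the spacing of the centres, so for positive [M] the open arcs with [j < M]
    overlap and leave no gap. *)
Definition arc (R : realType) (M j : nat) : set (circle R) :=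
  @mod1 R @` [set y | `|y - j%:R / M%:R| < M%:R^-1].

Lemma mod1P (R : realType) (x y : R) :
  mod1 x = mod1 y <-> exists k : int, x = y + k%:~R.
Proof.
have -> : (mod1 x = mod1 y) <-> (x - y) \in (Num.int_num_subdef : {pred R}).
  by rewrite Quotient.idealrBE; split=> [e|/eqP]; [apply/eqP|].
split.
  by move=> /intrP[k xyk]; exists k; rewrite -xyk addrC subrK.
by move=> [k ->]; apply/intrP; exists k; rewrite addrC addKr.
Qed.

Lemma arcP (R : realType) (M j : nat) (x : R) :
  arc R M j (mod1 x) <-> exists k : int, `|x - k%:~R - j%:R / M%:R| < M%:R^-1.
Proof.
split=> [[y /= yj /mod1P[k yk]]|[k xk]].
  by exists (- k); rewrite rmorphN opprK -yk.
by exists (x - k%:~R) => //; apply/mod1P; exists (- k); rewrite rmorphN.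
Qed.

Lemma open_arc (R : realType) (M j : nat) : open (arc R M j).
Proof.
rewrite /open /= /quotient_open.
rewrite (_ : _ @^-1` _ =
    \bigcup_(k : int) (fun x => x - k%:~R - j%:R / M%:R) @^-1` ball (0 : R) M%:R^-1).
  apply: bigcup_open => k _.
  apply: open_comp; last exact: ball_open.
  by move=> x _; apply: cvgB; [apply: cvgB => //; exact: cvg_cst|exact: cvg_cst].
apply/seteqP; split => [x /arcP[k xk]|x [k _ /= xk]].
  by exists k => //=; rewrite /ball /= sub0r normrN.
by apply/arcP; exists k; move: xk; rewrite /ball /= sub0r normrN.
Qed.

Lemma arc_cover (R : realType) (M : nat) (c : circle R) : (0 < M)%N ->
  exists2 j, (j < M)%N & arc R M j c.
Proof.
move=> M0; have MR0 : 0 < M%:R :> R by rewrite ltr0n.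
rewrite -(reprK c) -/(mod1 _); set x := repr c.
have y0 : 0 <= x - (Num.floor x)%:~R by rewrite subr_ge0 ge_floor.
have y1 : x - (Num.floor x)%:~R < 1.
  by rewrite ltrBlDr addrC -intrD1 lt_succ_floor.
move: y0 y1; set y := x - _ => y0 y1.
have My0 : 0 <= M%:R * y by rewrite mulr_ge0.
exists (Num.truncn (M%:R * y)).
  by rewrite truncn_lt_nat// -[ltRHS]mulr1 ltr_pM2l.
apply/arcP; exists (Num.floor x).
have /andP[h1 h2] := truncn_itv My0.
rewrite -/y -(ltr_pM2l MR0) mulfV ?gt_eqF// -{1}(ger0_norm (ltW MR0)) -normrM.
rewrite mulrBr mulrCA mulfV ?gt_eqF// mulr1 ger0_norm ?subr_ge0//.
by rewrite ltrBlDr addrC natr1.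
Qed.

(** * Measure of cylinders *)

(** A ball has measure [2 r], so [E] has density at most 1/2 at each point, whereas almost every
    point of [E] has density 1. *)
Lemma half_density_negligible (R : realType) (E : set R) :
  measurable E ->
  (forall x r, 0 < r -> (lebesgue_measure (E `&` ball x r) <= r%:E)%E) ->
  (@lebesgue_measure R).-negligible E.
Proof.
move=> mE Er.
have [N [mN N0 NE]] := lebesgue_density mE.
exists N; split=> // x Ex; apply: NE => /= cvgx.
have : ((\1_E x)%:E <= (2^-1 : R)%:E)%E.
  apply: (cvge_to_le cvgx).
  near=> r.
  have r0 : 0 < r by near: r; exact: nbhs_right_gt.
  rewrite lebesgue_measure_ball ?(ltW r0)// inver mulrn_eq0/= gt_eqF//.
  have -> : (2^-1 : R)%:E = (r%:E * ((r *+ 2)^-1)%:E)%E.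
    rewrite -EFinM; congr EFin.
    by rewrite -[r *+ 2]mulr_natr invfM mulrA mulfV ?gt_eqF// mul1r.
  by rewrite lee_pmul2r// ?lte_fin ?invr_gt0 ?mulrn_wgt0// Er.
by rewrite indicE mem_set//= lee_fin leNgt invf_lt1// ltr1n.
Unshelve. all: by end_near. Qed.

(** A piece of diameter at most [d] lies in the interval of radius [d] about any of its points; the
    factor 2 lost here is absorbed later by the size of [M]. *)
Lemma lebesgue_measure_le_diam (R : realType) (X : set R) (S : nat -> set R)
    (N : nat) (d : R) :
  measurable X -> 0 <= d ->
  (forall x, X x -> exists2 k, (k < N)%N & S k x) ->
  (forall k x y, S k x -> S k y -> `|x - y| <= d) ->
  (lebesgue_measure X <= (N%:R * (2 * d))%:E)%E.
Proof.
move=> mX d0 XS Sd.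
have /choice[c Hc] k : exists c, forall x, S k x -> `|x - c| <= d.
  have [[c Skc]|S0] := pselect (exists c, S k c).
    by exists c => x Skx; exact: Sd Skx Skc.
  by exists 0 => x Skx; exfalso; apply: S0; exists x.
pose F k : set R := `[c k - d, c k + d]%classic.
have muF k : lebesgue_measure (F k) = (2 * d)%:E.
  rewrite lebesgue_measure_itv/= lte_fin; case: ifPn => [_|].
    by rewrite -EFinB; congr EFin; ring.
  by rewrite -leNgt => h; congr EFin; lra.
apply: (@le_trans _ _ (\sum_(k < N) lebesgue_measure (F k))%E).
  apply: content_subadditive => //; first by move=> k _; exact: measurable_itv.
  move=> x /XS[k kN Skx]; rewrite -bigcup_mkord; exists k => //.
  by have := Hc k x Skx; rewrite /F /= in_itv/= ler_norml; lra.
under eq_bigr do rewrite muF.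
by rewrite sumEFin sumr_const card_ord -[(2 * d) *+ N]mulr_natl lexx.
Qed.

(** Words of arc indices are plain lists, so that finite families of them form the countable type
    [seq (seq nat)]; missing entries read as 0. *)
Definition cylinder (R : realType) (a : nat -> int) (M n m : nat) (t : seq nat)
  : set R :=
  [set x | forall i, (i < n)%N ->
    arc R M (nth 0%N t i) (mod1 ((a (m + i)%N)%:~R * x))].

Lemma measurable_cylinder (R : realType) (a : nat -> int) (M n m : nat)
  (t : seq nat) : measurable (cylinder R a M n m t).
Proof.
rewrite (_ : cylinder _ _ _ _ _ _ = \bigcap_(i in [set i | (i < n)%N])
  (fun x => (a (m + i)%N)%:~R * x) @^-1` (@mod1 R @^-1` arc R M (nth 0%N t i)))//.
apply: bigcap_measurableType => // i _.
apply: open_measurable; apply: open_comp; last exact: open_arc.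
by move=> x _; exact: mulrl_continuous.
Qed.

Lemma measurable_cylinders (R : realType) (a : nat -> int) (M n m : nat)
    (s : seq (seq nat)) :
  measurable [set x | exists2 t, t \in s & cylinder R a M n m t x].
Proof.
rewrite (_ : [set _ | _] = \bigcup_(t in [set` s]) cylinder R a M n m t).
  apply: fin_bigcup_measurable => [|t _]; first exact: finite_seq.
  exact: measurable_cylinder.
by apply/seteqP; split => x [t ts xt]; exists t.
Qed.

Lemma cylinder_measure_le (R : realType) (a : nat -> int) (M n m : nat)
    (s : seq (seq nat)) (q z r : R) :
  0 < q -> 0 < r -> 2 * (q + 1) <= M%:R ->
  (forall i, 0 < (a (m + i)%N)%:~R :> R) ->
  (forall i, (a (m + i.+1)%N)%:~R <= q * (a (m + i)%N)%:~R) ->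
  (lebesgue_measure
     ([set x | exists2 t, t \in s & cylinder R a M n.+1 m t x] `&` ball z r) <=
   ((size s)%:R * (2 * r * (a m)%:~R + 3) *
     (2 * (2 * M%:R^-1 / (a (m + n)%N)%:~R)))%:E)%E.
Proof.
move=> q0 r0 qM a0 aq.
have M0 : 0 < M%:R :> R by lra.
set h : R := M%:R^-1.
have h0 : 0 < h by rewrite invr_gt0.
have hq : 2 * h * (q + 1) <= 1.
  by rewrite -mulrA mulrCA mulrC ler_pdivrMr// mul1r.
pose c (t : seq nat) : R := (nth 0%N t 0)%:R / M%:R.
have am0 : 0 < (a m)%:~R :> R by have := a0 0%N; rewrite addn0.
(* For [x] in the ball and in the cylinder of [t], the integer at time [m] lies in an interval of
   length 2 r a(m) + 2 h. Rounding its left end down to [F t] adds at most 1, so the offset from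
   [F t] is below [K]. *)
pose K := (Num.truncn (2 * r * (a m)%:~R + 2 * h + 1)).+1.
have /truncn_itv/andP[K1 K2] : 0 <= 2 * r * (a m)%:~R + 2 * h + 1.
  by rewrite !addr_ge0 ?mulr_ge0// ltW.
pose F t : int := Num.floor ((a m)%:~R * (z - r) - c t - h).
(* The index [k] encodes a pair: its quotient by [K] is the position of the word in [s], its
   remainder the offset of the integer from [F t]. *)
pose S k : set R := [set x |
  let t := nth [::] s (k %/ K) in cylinder R a M n.+1 m t x /\
  `|(a m)%:~R * x - (F t + (k %% K)%N%:Z)%:~R - c t| < h].
(* Points of a cylinder sharing the integer part k at time m share all the later
   integer parts, so their distance is magnified up to time m + n unwrapped. *)
have step x y t k : cylinder R a M n.+1 m t x -> cylinder R a M n.+1 m t y ->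
    `|(a m)%:~R * x - k - c t| < h -> `|(a m)%:~R * y - k - c t| < h ->
    forall i, (i <= n)%N -> `|(a (m + i)%N)%:~R * (x - y)| < 2 * h.
  move=> tx ty kx ky; elim => [_|i IHi ni].
    rewrite addn0; move: kx ky; rewrite !ltr_norml mulrBr; lra.
  have [kx' hx] := (arcP _ _ _ _).1 (tx i.+1 ni).
  have [ky' hy] := (arcP _ _ _ _).1 (ty i.+1 ni).
  have B : `|(a (m + i.+1)%N)%:~R * (x - y)| < q * (2 * h).
    apply: le_lt_trans (_ : q * `|(a (m + i)%N)%:~R * (x - y)| < _).
      rewrite !normrM mulrA ler_wpM2r// !gtr0_norm//.
    by rewrite ltr_pM2l// IHi// ltnW.
  (* The two integers differ by less than 2 h + 2 h q, which is at most 1 by [hq]. *)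
  have kk : kx' = ky'.
    move: hx hy B; rewrite mulrBr -/h !ltr_norml => /andP[? ?] /andP[? ?] /andP[? ?].
    apply/le_anti; rewrite -!ltzD1 -!(ltr_int R) !intrD1.
    by apply/andP; split; lra.
  move: hx hy; rewrite kk mulrBr -/h !ltr_norml => /andP[? ?] /andP[? ?].
  by apply/andP; split; lra.
apply: (@le_trans _ _ ((size s * K)%:R * (2 * (2 * h / (a (m + n)%N)%:~R)))%:E).
  apply: (@lebesgue_measure_le_diam _ _ S).
  - apply: measurableI; last exact: measurable_ball.
    exact: measurable_cylinders.
  - by rewrite divr_ge0 ?mulr_ge0// ltW.
  - move=> x [[t ts tx] /=]; rewrite /ball/= => zx.
    have := tx 0%N isT; rewrite addn0 => /arcP[k kx].
    rewrite -/h -/(c t) in kx.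
    have [zx1 zx2] : z - r < x /\ x < z + r by move: zx; rewrite ltr_norml; lra.
    have azx1 : (a m)%:~R * (z - r) < (a m)%:~R * x by rewrite ltr_pM2l.
    have azx2 : (a m)%:~R * x < (a m)%:~R * (z + r) by rewrite ltr_pM2l.
    have /andP[F1 F2] := floor_itv ((a m)%:~R * (z - r) - c t - h).
    rewrite -/(F t) intrD1 in F1 F2.
    move: kx; rewrite ltr_norml => /andP[kx1 kx2].
    have Fk : F t <= k by rewrite -(ler_int R); lra.
    have [l kl] : exists l : nat, k = F t + l%:Z.
      by exists (absz (k - F t)); rewrite gez0_abs ?subr_ge0// [RHS]addrC subrK.
    have lK : (l < K)%N.
      rewrite -(ltr_nat R).
      rewrite -/K in K2; apply: le_lt_trans K2.
      move: kx1 kx2; rewrite kl rmorphD/= -pmulrn; lra.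
    exists (index t s * K + l)%N.
      apply: (@leq_trans ((index t s).+1 * K)%N).
        by rewrite mulSn addnC ltn_add2r.
      by rewrite leq_mul2r index_mem ts orbT.
    rewrite /S /= divnMDl// (divn_small lK) addn0 nth_index// modnMDl modn_small//.
    by split=> //; rewrite -kl ltr_norml; apply/andP; split.
  - move=> k x y [/= tx kx] [ty ky].
    have := step x y _ _ tx ty kx ky n (leqnn n).
    rewrite normrM gtr0_norm// => /ltW.
    by move=> H; rewrite ler_pdivlMr// mulrC.
rewrite lee_fin ler_wpM2r//.
  by rewrite mulr_ge0// divr_ge0 ?mulr_ge0// ltW.
rewrite natrM ler_wpM2l//.
have : K%:R <= 2 * r * (a m)%:~R + 2 * h + 2 :> R.
  by rewrite /K -natr1; lra.
(* As [q] is positive, [hq] gives 2 h <= 1, which turns the bound on [K] into 2 r a(m) + 3. *)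
have : 2 * h * 1 <= 2 * h * (q + 1) by rewrite ler_wpM2l//; lra.
lra.
Qed.

(** * Almost every point escapes few cylinders *)

Lemma increasing_int_ge (a : nat -> int) (n : nat) :
  increasing_seq a -> a 0%N + n%:Z <= a n.
Proof.
move=> a_incr; elim: n => [|n IHn]; first by rewrite addr0.
have : a n < a n.+1 by rewrite ltNge a_incr ltnn.
by rewrite -lezD1; apply: le_trans; rewrite intS [1 + _]addrC addrA lerD2r.
Qed.

Lemma increasing_int_cvgy (R : realType) (a : nat -> int) :
  increasing_seq a -> (fun n => (a n)%:~R : R) @ \oo --> +oo.
Proof.
move=> a_incr; apply/cvgryPge => b.
near=> n.
apply: (@le_trans _ _ ((a 0%N)%:~R + n%:R)).
  by rewrite -lerBlDl; near: n; exact: nbhs_infty_ger.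
have := increasing_int_ge a n a_incr.
by rewrite -(ler_int R) rmorphD/= -pmulrn.
Unshelve. all: by end_near. Qed.

(** The ratio telescopes into [n] consecutive ratios, each tending to [p]. Nonvanishing is asked
    only eventually, which admits a sequence passing through 0. *)
Lemma cvg_ratio_shift (R : realType) (a : nat -> R) (p : R) (n : nat) :
  (\forall m \near \oo, a m != 0) ->
  (fun m => a m.+1 / a m) @ \oo --> p ->
  (fun m => a (m + n)%N / a m) @ \oo --> p ^+ n.
Proof.
move=> a0 ap; elim: n => [|n IHn].
  apply: cvg_near_cst; near=> m.
  by rewrite addn0 divff//; near: m.
rewrite exprS.
apply: cvg_trans (cvgM (_ : (fun m => a (m + n).+1 / a (m + n)%N) @ \oo --> p) IHn).
  apply: near_eq_cvg; near=> m.
  have am : a (m + n)%N != 0.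
    near: m; have [N _ HN] := a0.
    by exists N => // m /= Nm; apply: HN; rewrite /= (leq_trans Nm) ?leq_addr.
  by rewrite /= addnS mulrA mulfVK.
by rewrite -(cvg_shiftn n) in ap.
Unshelve. all: by end_near. Qed.

Section AlmostEverywhere.
Variables (R : realType) (a : nat -> int) (p : R).
Hypothesis a_incr : increasing_seq a.
Hypothesis a_ratio : (fun n => (a n.+1)%:~R / (a n)%:~R : R) @ \oo --> p.

Let ay : (fun n => (a n)%:~R : R) @ \oo --> +oo.
Proof. exact: increasing_int_cvgy. Qed.

Let a_gt0 : \forall m \near \oo, 0 < (a m)%:~R :> R.
Proof. by apply: cvgry_gt. Qed.

Lemma ratio_limit_ge1 : 1 <= p.
Proof.
apply: (cvgr_to_ge a_ratio); near=> n.
have an : 0 < (a n)%:~R :> R by near: n.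
by rewrite ler_pdivlMr// mul1r ler_int a_incr.
Unshelve. all: by end_near. Qed.

(** The bound of [cylinder_measure_le] holds for every large [m], so its limit also bounds the
    intersection over all [m]. In that limit the additive 3 disappears against a(m), and a(m+n)/a(m)
    becomes [p ^+ n]. *)
Lemma negligible_cylinders (M n : nat) (s : seq (seq nat)) :
  (0 < M)%N -> 2 * (p + 2) <= M%:R -> 8 <= M%:R :> R ->
  (size s)%:R <= p ^+ n ->
  (@lebesgue_measure R).-negligible
    [set x | forall m, exists2 t, t \in s & cylinder R a M n.+1 m t x].
Proof.
move=> M0 pM M8 sp; have p1 := ratio_limit_ge1.
have MR0 : 0 < M%:R :> R by rewrite ltr0n.
have p0 : 0 < p ^+ n by rewrite exprn_gt0//; lra.
pose X m : set R := [set x | exists2 t, t \in s & cylinder R a M n.+1 m t x].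
have mX m : measurable (X m) by exact: measurable_cylinders.
rewrite (_ : [set _ | _] = \bigcap_m X m); last first.
  by apply/seteqP; split => x Xx m; [move=> _; exact: Xx|exact: (Xx m I)].
apply: half_density_negligible; first exact: bigcapT_measurable.
move=> z r r0.
have rcvg := cvg_ratio_shift R (fun m => (a m)%:~R) p n _ a_ratio.
have {}rcvg : (fun m => (a (m + n)%N)%:~R / (a m)%:~R : R) @ \oo --> p ^+ n.
  by apply: rcvg; apply: filterS a_gt0 => m /gt_eqF/negbT.
pose b m : R := (size s)%:R * (2 * r * (a m)%:~R + 3) *
  (2 * (2 * M%:R^-1 / (a (m + n)%N)%:~R)).
have bcvg : b @ \oo -->
    (size s)%:R * (4 * M%:R^-1) * ((2 * r + 3 * 0) * (p ^+ n)^-1).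
  apply: cvg_trans (_ : (fun m => (size s)%:R * (4 * M%:R^-1) *
    ((2 * r + 3 * ((a m)%:~R)^-1) *
      ((a (m + n)%N)%:~R / (a m)%:~R)^-1)) @ \oo --> _).
    apply: near_eq_cvg; near=> m.
    have am : 0 < (a m)%:~R :> R by near: m.
    have amn : 0 < (a (m + n)%N)%:~R :> R.
      by rewrite (lt_le_trans am)// ler_int a_incr leq_addr.
    by rewrite /b; field; rewrite !gt_eqF.
  apply: cvgMr; apply: cvgM; last by apply: cvgV => //; rewrite gt_eqF.
  apply: cvgD; first exact: cvg_cst.
  by apply: cvgMr; apply/gtr0_cvgV0.
set l := (X in _ --> X) in bcvg.
(* The limit is (size s / p^n) (8 / M) r with the first two factors at most 1, so it is at most half
   the measure of the ball. *)
apply: (@le_trans _ _ l%:E); last first.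
  rewrite lee_fin /l mulr0 addr0.
  rewrite (_ : _ * _ = (size s)%:R / p ^+ n * (8 / M%:R) * r); last first.
    by field; rewrite !gt_eqF.
  rewrite ler_piMl ?(ltW r0)// -[leRHS]mulr1 ler_pM ?divr_ge0 ?(ltW p0)//.
    by rewrite ler_pdivrMr// mul1r.
  by rewrite ler_pdivrMr// mul1r.
have bE : (EFin \o b) @ \oo --> l%:E.
  by apply/fine_cvgP; split; [exact: nearW|exact: bcvg].
apply: (cvge_to_ge bE).
(* Tolerance 1 makes all ratios from [N] on at most [p + 1], the value of [q] to which the
   hypothesis on [M] is fitted. *)
have /cvgrPdist_le/(_ _ ltr01) near_p := a_ratio.
have [N _ HN] := filterI a_gt0 near_p.
exists N => // m /= Nm.
apply: (@le_trans _ _ (lebesgue_measure (X m `&` ball z r))).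
  apply: le_measure.
  - apply: mem_set; apply: measurableI; first exact: bigcapT_measurable.
    exact: measurable_ball.
  - apply: mem_set; apply: measurableI; [exact: mX|exact: measurable_ball].
  - by apply: setSI => x; exact.
have mN i : (N <= m + i)%N by rewrite (leq_trans Nm)// leq_addr.
apply: (@cylinder_measure_le _ _ _ _ _ _ (p + 1)) => //.
- by lra.
- by rewrite -addrA.
- by move=> i; have [] := HN _ (mN i).
- move=> i; have [am] := HN _ (mN i).
  rewrite distrC ler_norml => /andP[_].
  by rewrite lerBlDr ler_pdivrMr// addrC addnS.
Unshelve. all: by end_near. Qed.

Lemma ae_not_covered (M : nat) :
  (0 < M)%N -> 2 * (p + 2) <= M%:R -> 8 <= M%:R :> R ->
  {ae (@lebesgue_measure R), forall x : R, forall (n : nat) (s : seq (seq nat)),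
    (forall m, exists2 t, t \in s & cylinder R a M n.+1 m t x) ->
    p ^+ n < (size s)%:R}.
Proof.
move=> M0 pM M8.
(* The pairs [(n, s)] are enumerated through [pickle], which makes the exceptional set a countable
   union of null sets. Codes that decode to nothing, or to a family of more than [p ^+ n] words,
   exclude no [x]. *)
pose P (k : nat) (x : R) := forall (n : nat) (s : seq (seq nat)),
  choice.unpickle k = Some (n, s) ->
  (forall m, exists2 t, t \in s & cylinder R a M n.+1 m t x) ->
  p ^+ n < (size s)%:R.
have : {ae (@lebesgue_measure R), forall x k, P k x}.
  apply: ae_foralln => k.
  case Ek : (choice.unpickle k : option (nat * seq (seq nat))) => [[n s]|]; last first.
    by apply: aeW => x n s; rewrite Ek.
  have [sp|sp] := leP (size s)%:R (p ^+ n); last first.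
    by apply: aeW => x n' s'; rewrite Ek => -[<- <-].
  have := negligible_cylinders M n s M0 pM M8 sp.
  apply: negligibleS => x /= Px; apply: contrapT => Nx; apply: Px => n' s'.
  by rewrite Ek => -[<- <-] xs; exfalso; exact: Nx.
apply: (@filterS _ _ (ae_filter_ringOfSetsType _)) => x Px n s.
apply: (Px (choice.pickle (n, s))).
exact: choice.pickleK.
Qed.
End AlmostEverywhere.

(** * The orbit space *)

Lemma proj_ptws_continuous (K : topologicalType) (i : nat) :
  continuous (fun w : {ptws nat -> K} => w i).
Proof. exact: (@proj_continuous nat (fun=> K) i). Qed.

(** The product topology is the supremum of the topologies induced by the coordinates, and
    coordinate [i] of the shift is coordinate [i.+1]. *)
Lemma seq_shift_continuous (K : topologicalType) : continuous (@seq_shift K).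
Proof.
move=> w; apply/cvg_sup; first exact/fmap_filter/(nbhs_filter w).
move=> i U [_ [[V oV <-] Vw] VU].
have /(proj_ptws_continuous K i.+1 w) : nbhs (w i.+1) V by apply: open_nbhs_nbhs.
by apply: (@filterS _ _ (nbhs_filter w)) => v Vv; exact: (VU (seq_shift v)).
Qed.

Lemma iter_seq_shift (K : topologicalType) (n i : nat) (w : {ptws nat -> K}) :
  iter n (@seq_shift K) w i = w (n + i)%N.
Proof. by elim: n i => //= n IHn i; rewrite /seq_shift IHn addnS. Qed.

Lemma orbit_space_orbit (K : topologicalType) (x : nat -> K) (m : nat) :
  orbit_space x (fun n => x (m + n)%N).
Proof.
by split=> [n|]; apply: subset_closure; [exists (m + n)%N|exists m].
Qed.

Lemma orbit_space_shift (K : topologicalType) (x : nat -> K)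
  (w : {ptws nat -> K}) : orbit_space x w -> orbit_space x (seq_shift w).
Proof.
move=> [xw clw]; split=> [n|V]; first exact: xw.
move=> /(seq_shift_continuous K w)/clw[_ [[m _ <-] Vm]].
exists (seq_shift (fun n => x (m + n)%N)); split=> //.
exists m.+1 => //; apply/funext => n.
by rewrite /seq_shift addnS.
Qed.

Section ArcCover.
Variables (R : realType) (M : nat) (x : nat -> circle R).

Definition arc_cover_of : set (set {ptws nat -> circle R}) :=
  [set orbit_space x `&` [set w | arc R M j (w 0%N)] | j in [set j | (j < M)%N]].

Lemma is_open_cover_arc_cover_of :
  (0 < M)%N -> is_open_cover (orbit_space x) arc_cover_of.
Proof.
move=> M0; split; first split.
- by move=> _ [j _ <-] w [].
- apply/seteqP; split; first by move=> w [_ [j _ <-] []].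
  move=> w xw; have [j jM wj] := arc_cover R M (w 0%N) M0.
  by exists (orbit_space x `&` [set w | arc R M j (w 0%N)]) => //; exists j.
- move=> _ [j jM <-]; exists [set w | arc R M j (w 0%N)] => //.
  apply: (@open_comp _ _ (fun w : {ptws nat -> circle R} => w 0%N)).
    by move=> w _; exact: proj_ptws_continuous.
  exact: open_arc.
Qed.

Lemma finite_arc_cover_of : finite_set arc_cover_of.
Proof. by apply: finite_image; exact: finite_II. Qed.

(** Each subcover element yields a word of arc indices. All tails of [x] are points of the orbit
    space, so each is covered and follows one of these words. *)
Lemma subcover_card_arcs (n k : nat) :
  subcover_card (orbit_space x) (@seq_shift _) arc_cover_of n k ->
  exists s : seq (seq nat), size s = k /\
    forall m, exists2 t, t \in s & forall i, (i < n)%N ->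
      arc R M (nth 0%N t i) (x (m + i)%N).
Proof.
move=> [V [Vn [VA covV] cardV]].
have finV : finite_set V by exists k.
have /choice[t Ht] W : exists t : seq nat, V W -> forall w, W w ->
    forall i, (i < n)%N -> arc R M (nth 0%N t i) (w i).
  have [VW|nVW] := pselect (V W); last by exists [::].
  have := Vn _ VW; rewrite cover_iter_joinE => -[B UB ->].
  have /choice[j Hj] i : exists j, (i < n)%N ->
      B i = orbit_space x `&` [set w | arc R M j (w 0%N)].
    case: (ltnP i n) => [/UB[j _ <-]|_]; first by exists j.
    by exists 0%N.
  exists (mkseq j n) => _ w [_ Bw] i ni.
  have := Bw i ni; rewrite Hj// => -[_ /=].
  by rewrite -[w i]/(w (0 + i)%N) addnC -iter_seq_shift nth_mkseq.
exists [seq t W | W <- fset_set V]; split.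
  by rewrite size_map; exact: card_fset_set.
move=> m; have := orbit_space_orbit _ x m; rewrite -{1}covV => -[W VW Wm].
exists (t W); last exact: (Ht W VW).
by apply: map_f; rewrite in_fset_set// mem_set.
Qed.

End ArcCover.

Theorem theorem1p4 (R : realType) (a : nat -> int) (p : R)
    (a_incr : increasing_seq a)
    (a_ratio : (fun n => (a n.+1)%:~R / (a n)%:~R : R) @ \oo --> p) :
  {ae (@lebesgue_measure R), forall x : R,
    ((ln p)%:E <= anqie_entropy (fun n => mod1 ((a n)%:~R * x)) R)%E}.
Proof.
have p1 := ratio_limit_ge1 R a p a_incr a_ratio.
have p0 : 0 < p by lra.
have [M [M0 pM M8]] : exists M : nat, [/\ (0 < M)%N, 2 * (p + 2) <= M%:R
    & 8 <= M%:R :> R].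
  (* The term [2 * (p + 2)] serves the uniqueness of integer parts under the ratio bound [p + 1],
     the [8] the halving of measure. *)
  exists (Num.truncn (2 * (p + 2) + 8)).+1; split=> //.
    have /truncn_itv/andP[_] : 0 <= 2 * (p + 2) + 8 by lra.
    by lra.
  have /truncn_itv/andP[_] : 0 <= 2 * (p + 2) + 8 by lra.
  by lra.
have := ae_not_covered R a p a_incr a_ratio M M0 pM M8.
apply: (@filterS _ _ (ae_filter_ringOfSetsType _)) => x Hx.
set xi := fun n => mod1 _.
have oU := is_open_cover_arc_cover_of R M xi M0.
apply: (@le_trans _ _ (cover_entropy (orbit_space xi) (@seq_shift _) R
    (arc_cover_of R M xi))); last first.
  by apply: ereal_sup_ubound; exists (arc_cover_of R M xi).
have A0 : orbit_space xi !=set0.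
  by exists (fun n => xi (0 + n)%N); exact: orbit_space_orbit.
(* The constant [p^-1] appears because subcovers of the [n.+1]-th join are bounded below by
   [p ^+ n]; for the empty join it only asks for one element. *)
apply: (cover_entropy_ge _ _ _ _ _ p^-1) => //.
- exact: orbit_space_shift.
- exact: oU.1.
- exact: finite_arc_cover_of.
- by rewrite invr_gt0.
- case=> [|n] k Uk.
    rewrite mulr1 (le_trans (_ : p^-1 <= 1))// ?invf_le1// ler1n.
    exact: subcover_card_gt0 A0 Uk.
  rewrite exprS mulKf ?gt_eqF//.
  have [s [<- sx]] := subcover_card_arcs _ _ _ _ _ Uk.
  exact/ltW/Hx.
Qed.
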